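(* Let $R$ be a commutative ring and $M$ a nonzero $R$-module. The following statements are equivalent: (1) $M$ is weakly-morphic and reduced; (2) $M$ is weakly-morphic and co-reduced; (3) $M$ is co-reduced and reduced; (4) $M$ is weakly-endoregular.
   Context: Rings are associative and unital; modules are unitary right modules. For $a\in R$ put $l_M(a)=\{m\in M: ma=0\}$ and $Ma=\{ma: m\in M\}$. Definitions for an $R$-module $M$ over a commutative ring $R$: - $M$ is weakly-morphic if $M/Ma\cong l_M(a)$ as $R$-modules for each $a\in R$. - $M$ is reduced if whenever $a\in R$, $m\in M$ satisfy $ma^2=0$, then $mRa=0$. - $M$ is co-reduced if $Ma=Ma^n$ for every $a\in R$ and every positive integer $n$. - $M$ is weakly-endoregular if $Ma$ and $l_M(a)$ are direct summands of $M$ for each $a\in R$. *)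

(* Defs.v *)
From HB Require Import structures.
From mathcomp Require Import all_boot all_algebra.
From mathcomp Require Import boolp.

Set Implicit Arguments.
Unset Strict Implicit.
Unset Printing Implicit Defensive.

Import GRing.Theory.

Local Open Scope ring_scope.
Local Open Scope quotient_scope.

(* Over a commutative ring R, right and left R-modules coincide: a right
   module M is a value of lmodType R, and the product m a is a *: m. *)

(* Membership is boolean; the classical [asbool] turns any Prop-valued
   submodule into one of these. *)
Record submodule (R : pzRingType) (M : lmodType R) := Submodule {
  submod_pred :> {pred M};
  submod_predP : submod_closed submod_pred
}.

HB.instance Definition _ (R : pzRingType) (M : lmodType R)
    (N : submodule M) :=
  GRing.isSubmodClosed.Build R M (submod_pred N) (submod_predP N).

Section SubmoduleType.
Variables (R : pzRingType) (M : lmodType R) (N : submodule M).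

Record submod_of := SubmodOf { submod_val : M; _ : submod_val \in N }.

HB.instance Definition _ := [isSub for submod_val].
HB.instance Definition _ := [Choice of submod_of by <:].
HB.instance Definition _ := [SubChoice_isSubLmodule of submod_of by <:].

End SubmoduleType.

Section QuotientModule.
Variables (R : pzRingType) (M : lmodType R) (N : submodule M).

Definition quotmod := Quotient.quot (submod_pred N).

HB.instance Definition _ := ZmodQuotient.on quotmod.

Definition quotmod_scale (a : R) : quotmod -> quotmod :=
  lift_op1 quotmod ( *:%R a).

Lemma pi_quotmod_scale a :
  {morph \pi_quotmod : m / a *: m >-> quotmod_scale a m}.
Proof.
move=> m; unlock quotmod_scale; apply/eqP.
rewrite -Quotient.idealrBE -scalerBr rpredZ //.
by rewrite Quotient.idealrBE reprK.
Qed.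

Lemma quotmod_scalerA a b x :
  quotmod_scale a (quotmod_scale b x) = quotmod_scale (a * b) x.
Proof. by rewrite -[x]reprK -!pi_quotmod_scale scalerA. Qed.

Lemma quotmod_scale1r : left_id 1 quotmod_scale.
Proof. by move=> x; rewrite -[x]reprK -pi_quotmod_scale scale1r. Qed.

Lemma quotmod_scalerDr : right_distributive quotmod_scale +%R.
Proof.
move=> a x y; rewrite -[x]reprK -[y]reprK -raddfD -!pi_quotmod_scale.
by rewrite scalerDr raddfD.
Qed.

Lemma quotmod_scalerDl x : {morph quotmod_scale^~ x : a b / a + b}.
Proof.
by move=> a b; rewrite -[x]reprK -!pi_quotmod_scale scalerDl raddfD.
Qed.

HB.instance Definition _ := GRing.Zmodule_isLmodule.Build R quotmod
  quotmod_scalerA quotmod_scale1r quotmod_scalerDr quotmod_scalerDl.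

End QuotientModule.

Section SubmodulesOfAnElement.
Variables (R : comPzRingType) (M : lmodType R) (a : R).

Definition mul_pred : {pred M} := [pred m | `[< exists x : M, m = a *: x >]].

Definition ann_pred : {pred M} := [pred m | a *: m == 0].

Lemma mul_pred_closed : submod_closed mul_pred.
Proof.
split; first by apply/asboolP; exists 0; rewrite scaler0.
move=> b m n /asboolP[x ->] /asboolP[y ->]; apply/asboolP.
by exists (b *: x + y); rewrite scalerDr !scalerA mulrC.
Qed.

Lemma ann_pred_closed : submod_closed ann_pred.
Proof.
split; first by rewrite inE scaler0.
move=> b m n; rewrite !inE => /eqP m0 /eqP n0.
by rewrite scalerDr scalerA mulrC -scalerA m0 n0 scaler0 addr0.
Qed.

Definition mul_sub : submodule M := Submodule mul_pred_closed.

Definition ann_sub : submodule M := Submodule ann_pred_closed.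

End SubmodulesOfAnElement.

Arguments mul_sub {R} M a.
Arguments ann_sub {R} M a.

Definition lmod_isomorphic (R : pzRingType) (U V : lmodType R) : Prop :=
  exists f : {linear U -> V}, bijective f.

Definition direct_summand (R : pzRingType) (M : lmodType R)
    (N : submodule M) : Prop :=
  exists K : submodule M,
    (forall m : M, exists x y, [/\ x \in N, y \in K & m = x + y]) /\
    (forall m : M, m \in N -> m \in K -> m = 0).

Section ModuleProperties.
Variables (R : comPzRingType) (M : lmodType R).

Definition weakly_morphic : Prop :=
  forall a : R,
    lmod_isomorphic (quotmod (mul_sub M a)) (submod_of (ann_sub M a)).

Definition reduced_module : Prop :=
  forall (a : R) (m : M), a ^+ 2 *: m = 0 -> forall r : R, a *: (r *: m) = 0.

Definition coreduced_module : Prop :=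
  forall (a : R) (n : nat), (0 < n)%N -> mul_sub M a =i mul_sub M (a ^+ n).

Definition weakly_endoregular : Prop :=
  forall a : R,
    direct_summand (mul_sub M a) /\ direct_summand (ann_sub M a).

End ModuleProperties.

(* Main.v *)
From HB Require Import structures.
Require Import Defs.
From mathcomp Require Import all_boot all_algebra.
From mathcomp Require Import boolp.

(** Write [aM] for the image and [l(a)] for the kernel of multiplication by
    [a].  Co-reducedness amounts to [aM] being contained in [a^2 M] for every
    [a], and reducedness to [l(a^2)] being contained in [l(a)].

    Isomorphic modules are annihilated by the same scalars.  A scalar [a]
    annihilates [M / bM] iff [aM] lies in [bM], and annihilates [l(b)] iff
    [l(b)] lies in [l(a)].  So in a weakly-morphic module these two inclusions
    are equivalent ([weakly_morphic_duality]); taking [b = a^2] shows that such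
    a module is reduced iff it is co-reduced.

    Both properties together make [M] the internal direct sum of [aM] and
    [l(a)] for every [a] ([mul_ann_decomposition], [mul_ann_disjoint]).  This gives
    the summands required by weak endoregularity, and it identifies [M / aM]
    with [l(a)] ([coreduced_reduced_weakly_morphic]).

    Conversely, suppose that [M] is weakly-endoregular.  A complement [K] of
    [aM] is killed by [a], because [aK] lies in [aM] and in [K]; hence
    [aM = a(aM + K) = a^2 M].  On a complement [L] of [l(a)], multiplication by
    [a] is injective with values in [L], so [a^2] is injective on [L] too and
    [l(a^2) = l(a)]. *)

Set Implicit Arguments.
Unset Strict Implicit.
Unset Printing Implicit Defensive.

Import GRing.Theory.
Local Open Scope ring_scope.
Local Open Scope quotient_scope.

Lemma lmod_isomorphic_sym (R : pzRingType) (U V : lmodType R) :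
  lmod_isomorphic U V -> lmod_isomorphic V U.
Proof.
case=> f [g fK gK].
pose gL := GRing.isLinear.Build R V U *:%R g (can2_linear fK gK).
pose gl : {linear V -> U} := HB.pack g gL.
by exists gl; exists f.
Qed.

Lemma lmod_isomorphic_annihilated (R : pzRingType) (U V : lmodType R) (a : R) :
  lmod_isomorphic U V -> (forall u : U, a *: u = 0) -> forall v : V, a *: v = 0.
Proof. by case=> f [g _ gK] aU v; rewrite -[v]gK -linearZ aU linear0. Qed.

Lemma inj_surj_bijective (T U : Type) (f : T -> U) :
  injective f -> (forall y, exists x, f x = y) -> bijective f.
Proof.
move=> f_inj /choice[g gK].
by exists g => // x; apply: f_inj; rewrite gK.
Qed.

Lemma pi_quotmod_eq0 (R : pzRingType) (M : lmodType R) (N : submodule M)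
    (m : M) : (\pi_(quotmod N) m == 0) = (m \in N).
Proof. by rewrite -[m in RHS]subr0 Quotient.idealrBE raddf0. Qed.

Lemma pi_quotmodZ (R : pzRingType) (M : lmodType R) (N : submodule M)
    (a : R) (m : M) : \pi_(quotmod N) (a *: m) = a *: \pi_(quotmod N) m.
Proof. exact: pi_quotmod_scale. Qed.

Section Scalars.
Variables (R : comPzRingType) (M : lmodType R).
Implicit Types (a b : R) (m : M).

Lemma mul_subP a m : reflect (exists x, m = a *: x) (m \in mul_sub M a).
Proof. exact: asboolP. Qed.

Lemma ann_subP a m : reflect (a *: m = 0) (m \in ann_sub M a).
Proof. exact: eqP. Qed.

Lemma quotmod_mul_annihilated a b :
  (forall q : quotmod (mul_sub M b), a *: q = 0) <->
  (forall m, exists n, a *: m = b *: n).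
Proof.
split=> [aQ m | aM q].
  by apply/mul_subP; rewrite -pi_quotmod_eq0 pi_quotmodZ aQ.
rewrite -[q]reprK -pi_quotmodZ; apply/eqP; rewrite pi_quotmod_eq0.
exact/mul_subP/aM.
Qed.

Lemma submod_ann_annihilated a b :
  (forall v : submod_of (ann_sub M b), a *: v = 0) <->
  (forall m, b *: m = 0 -> a *: m = 0).
Proof.
split=> [aV m /ann_subP bm | aM v].
  by have /(congr1 val) := aV (SubmodOf bm).
by apply: val_inj; apply: aM; apply/ann_subP/(valP v).
Qed.

(** Both sides say that [a] annihilates one of the isomorphic modules
    [M / bM] and [l(b)]. *)
Lemma weakly_morphic_duality a b : weakly_morphic M ->
  (forall m, exists n, a *: m = b *: n) <->
  (forall m, b *: m = 0 -> a *: m = 0).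
Proof.
move=> /(_ b) iso_b.
rewrite -quotmod_mul_annihilated -submod_ann_annihilated.
split; apply: lmod_isomorphic_annihilated => //.
exact: lmod_isomorphic_sym.
Qed.

Lemma reduced_moduleE :
  reduced_module M <-> forall a m, a ^+ 2 *: m = 0 -> a *: m = 0.
Proof.
split=> [redM a m /redM/(_ 1) | redM a m /redM am0 r]; first by rewrite scale1r.
by rewrite scalerA mulrC -scalerA am0 scaler0.
Qed.

(** From [aM = a^2 M] one gets [aM = a^n M] by pulling out one more factor [a]
    at a time. *)
Lemma coreduced_moduleE :
  coreduced_module M <-> forall a m, exists n, a *: m = a ^+ 2 *: n.
Proof.
split=> [coM a m | coM a n n_gt0 m].
  by apply/mul_subP; rewrite -(coM a 2%N) //; apply/mul_subP; exists m.
case: n n_gt0 => // n _; apply/mul_subP/mul_subP => [[x ->] | [x ->]].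
  elim: n => [|n [y ->]]; first by exists x; rewrite expr1.
  have [z az] := coM a y.
  by exists z; rewrite exprSr -scalerA az scalerA -exprD addn2.
by exists (a ^+ n *: x); rewrite scalerA exprS.
Qed.

(** If [am = a^2 n], then [m - an] lies in [l(a)]. *)
Lemma mul_ann_decomposition a : coreduced_module M ->
  forall m, exists x y,
    [/\ x \in mul_sub M a, y \in ann_sub M a & m = x + y].
Proof.
move=> /coreduced_moduleE coM m; have [n am] := coM a m.
exists (a *: n), (m - a *: n); split; last by rewrite addrC subrK.
  by apply/mul_subP; exists n.
by apply/ann_subP; rewrite scalerBr am scalerA subrr.
Qed.

Lemma mul_ann_disjoint a : reduced_module M ->
  forall m, m \in mul_sub M a -> m \in ann_sub M a -> m = 0.
Proof.
move=> /reduced_moduleE redM m /mul_subP[x ->] /ann_subP aax.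
by apply: redM; rewrite expr2 -scalerA.
Qed.

Lemma direct_summand_compl (N K : submodule M) :
    (forall m, exists x y, [/\ x \in N, y \in K & m = x + y]) ->
    (forall m, m \in N -> m \in K -> m = 0) ->
  direct_summand N /\ direct_summand K.
Proof.
move=> NK_sum NK0; split; first by exists K.
exists N; split=> [m | m mK mN]; last exact: NK0.
by have [x [y [xN yK ->]]] := NK_sum m; exists y, x; rewrite addrC.
Qed.

(** The restriction to [K] of the projection onto [M / N]: it is injective as
    [N] and [K] are disjoint, and surjective as they span [M]. *)
Lemma quotmod_compl_iso (N K : submodule M) :
    (forall m, exists x y, [/\ x \in N, y \in K & m = x + y]) ->
    (forall m, m \in N -> m \in K -> m = 0) ->
  lmod_isomorphic (quotmod N) (submod_of K).
Proof.
move=> NK_sum NK0; apply: lmod_isomorphic_sym.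
pose f (v : submod_of K) := \pi_(quotmod N) (val v).
have f_lin : linear f.
  by move=> b u v; rewrite /f linearP raddfD /= pi_quotmodZ.
pose fL := GRing.isLinear.Build R _ _ *:%R f f_lin.
pose fl : {linear submod_of K -> quotmod N} := HB.pack f fL.
exists fl; apply: inj_surj_bijective => [u v fuv | q].
  apply/eqP; rewrite -subr_eq0; apply/eqP/val_inj/NK0; last exact: valP.
  by rewrite -pi_quotmod_eq0 -[_ == 0]/(fl (u - v) == 0) linearB fuv subrr.
have [x [y [xN yK def_q]]] := NK_sum (repr q).
exists (SubmodOf yK); rewrite -[q]reprK def_q raddfD /=.
by have /eqP-> : \pi_(quotmod N) x == 0; rewrite ?pi_quotmod_eq0 // add0r.
Qed.

Lemma coreduced_reduced_weakly_morphic :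
  coreduced_module M -> reduced_module M -> weakly_morphic M.
Proof.
move=> coM redM a; apply: quotmod_compl_iso.
  exact: mul_ann_decomposition.
exact: mul_ann_disjoint.
Qed.

(** A complement of [aM] is killed by [a], as its image under [a] lies both in
    [aM] and in the complement. *)
Lemma direct_summand_mul a : direct_summand (mul_sub M a) ->
  forall m, exists n, a *: m = a ^+ 2 *: n.
Proof.
case=> K [aMK_sum aMK0] m; have [_ [y [/mul_subP[n ->] yK ->]]] := aMK_sum m.
have ay0 : a *: y = 0.
  by apply: aMK0; [apply/mul_subP; exists y | exact: rpredZ].
by exists n; rewrite scalerDr ay0 addr0 scalerA.
Qed.

(** A complement of [l(a)] is stable under [a], and [a] is injective on it, so
    [a^2] is injective on it as well. *)
Lemma direct_summand_ann a : direct_summand (ann_sub M a) ->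
  forall m, a ^+ 2 *: m = 0 -> a *: m = 0.
Proof.
case=> L [laL_sum laL0] m; have [x [y [/ann_subP ax0 yL ->]]] := laL_sum m.
rewrite expr2 -scalerA scalerDr ax0 add0r => aay0.
by apply: laL0; [apply/ann_subP | exact: rpredZ].
Qed.

End Scalars.

Theorem theorem1 (R : comPzRingType) (M : lmodType R)
    (M_nonzero : exists m : M, m != 0) :
  [<-> weakly_morphic M /\ reduced_module M;
       weakly_morphic M /\ coreduced_module M;
       coreduced_module M /\ reduced_module M;
       weakly_endoregular M].
Proof.
tfae.
- case=> wM /reduced_moduleE redM; split=> //; apply/coreduced_moduleE => a.
  by apply/(weakly_morphic_duality _ _ wM)/redM.
- case=> wM coM; split=> //; apply/reduced_moduleE => a.
  by apply/(weakly_morphic_duality _ _ wM); move/coreduced_moduleE: coM; apply.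
- case=> coM redM a; apply: direct_summand_compl.
    exact: mul_ann_decomposition.
  exact: mul_ann_disjoint.
- move=> endoM.
  have redM : reduced_module M.
    by apply/reduced_moduleE => a; have [_ /direct_summand_ann] := endoM a.
  have coM : coreduced_module M.
    by apply/coreduced_moduleE => a; have [/direct_summand_mul] := endoM a.
  by split=> //; apply: coreduced_reduced_weakly_morphic.
Qed.
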